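(* (1) Let $M$ be a valuated matroid on a finite set $E$. Then $Q_M$ is atomic, semimodular and strongly torsion-free as an $\mathbb{R}_{\max}$-module. (2) Every finitely generated atomic, semimodular and strongly torsion-free $\mathbb{R}_{\max}$-module $N$ arises in this way from a simple valuated matroid, i.e. there is a simple valuated matroid $M$ on a finite set with $N\cong Q_M$ as $\mathbb{R}_{\max}$-modules. In addition, this simple valuated matroid is unique up to projective equivalence.
   Context: $\mathbb{R}_{\max}=\mathbb{R}\cup\{-\infty\}$ with addition $\max$ and multiplication the usual addition of reals, written multiplicatively; zero $0:=-\infty$, unit $1$ (the real number $0$), $\mathbb{R}_{\max}^\times=\mathbb{R}$. Modules are commutative monoids with an action satisfying the usual module axioms; a module over $\mathbb{R}_{\max}$ is ordered by $x\le y\iff x+y=y$. Valuated matroid on a finite set $E$ (circuit description): a collection $\mathcal{C}\subseteq \mathbb{R}_{\max}^E$ of functions, called circuits, such that, writing $\underline{X}=\{e\in E\mid X(e)\ne-\infty\}$: the constant function $-\infty$ is not in $\mathcal{C}$; if $X,Y\in\mathcal{C}$ and $\underline X\neq\underline Y$ then $\underline X\not\subseteq\underline Y$; if $X\in\mathcal{C}$ and $a\in\mathbb{R}_{\max}^\times$ then $aX\in\mathcal{C}$; and for $X,Y\in\mathcal{C}$ and $u,v\in E$ with $X(u)=Y(u)\neq-\infty$ and $X(v)>Y(v)$ there is $Z\in\mathcal{C}$ with $Z(u)=-\infty$, $Z(v)=X(v)$ and $Z\le\max(X,Y)$ pointwise. It is simple if every circuit has support of size at least $3$ (the underlying matroid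 is simple). $Q_M$ is the quotient of the free $\mathbb{R}_{\max}$-module on $E$ by the congruence generated by $\sum_{y\in E}c(y)y=\sum_{y\in E\setminus\{x\}}c(y)y$ for every circuit $c$ and every $x\in E$. Projective equivalence from $M$ (on $E$) to $M'$ (on $E'$): a pair $(\phi,s)$ with $\phi:E\to E'$ a bijection and $s:E\to\mathbb{R}_{\max}^\times$ such that $\eta:E\to\mathbb{R}_{\max}$ is a circuit of $M$ iff $y\mapsto s(\phi^{-1}(y))\eta(\phi^{-1}(y))$ is a circuit of $M'$. $M,M'$ are projectively equivalent if such a pair exists. Let $N$ be an $\mathbb{R}_{\max}$-module, $\mathcal{O}=\{a\in\mathbb{R}_{\max}\mid a\le1\}$. For $x\le y$ in $N$, $[x,y]=\{z\mid x\le z\le y\}$. $y$ weakly covers $x$ ($x\preceq y$) if $x\le y$ and every element of $[x,y]$ has the form $x+ay$ with $a\in\mathcal{O}$. $y$ covers $x$ if $x\le y$ and the map $\mathcal{O}\to[x,y]$, $a\mapsto x+ay$, is a bijection. $x$ is an atom if it covers $0$. $N$ is atomic if every element is a (finite, possibly empty) sum of atoms. $N$ is semimodular if $x\preceq y$ implies $x+z\preceq y+z$ for all $x,y,z\in N$. $N$ is strongly torsion-free if (i) $ax\ne0$ whenever $x\in N\setminus\{0\}$ and $a\in\mathbb{R}_{\max}\setminus\{0\}$, and (ii) whenever $x\le y$ in $N$, $a,b\in\mathcal{O}$ and $x+ay=x+by$, then $a=b$ or $x=x+ay=x+by$. *)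

(* Defs.v *)
From HB Require Import structures.
From mathcomp Require Import all_boot all_order all_algebra.
From mathcomp Require Import generic_quotient.
From mathcomp Require Import boolp classical_sets functions reals.

Set Implicit Arguments.
Unset Strict Implicit.
Unset Printing Implicit Defensive.

Import Order.TTheory GRing.Theory Num.Theory.

Local Open Scope ring_scope.
Local Open Scope quotient_scope.

(* The max-plus semifield R U {-oo}, written multiplicatively: in ring_scope,
   + is max, * is the addition of R, 0 is NInf, and 1 is Fin 0. *)
Variant Rmax (R : Type) : Type := NInf | Fin of R.
Arguments NInf {R}.

Section RmaxInstances.
Variable R : realType.

Definition opt_of_Rmax (x : Rmax R) : option R :=
  if x is Fin a then Some a else None.
Definition Rmax_of_opt (o : option R) : Rmax R :=
  if o is Some a then Fin a else NInf.
Lemma opt_of_RmaxK : cancel opt_of_Rmax Rmax_of_opt.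
Proof. by case. Qed.

HB.instance Definition _ := Choice.copy (Rmax R) (can_type opt_of_RmaxK).

Definition add_Rmax (x y : Rmax R) : Rmax R :=
  match x, y with
  | NInf, _ => y
  | _, NInf => x
  | Fin a, Fin b => Fin (Num.max a b)
  end.

Definition mul_Rmax (x y : Rmax R) : Rmax R :=
  match x, y with
  | Fin a, Fin b => Fin (a + b)
  | _, _ => NInf
  end.

Definition le_Rmax (x y : Rmax R) : bool :=
  match x, y with
  | NInf, _ => true
  | Fin _, NInf => false
  | Fin a, Fin b => a <= b
  end.

Lemma add_RmaxA : associative add_Rmax.
Proof. by case=> [|a] [|b] [|c] //=; rewrite maxA. Qed.
Lemma add_RmaxC : commutative add_Rmax.
Proof. by case=> [|a] [|b] //=; rewrite maxC. Qed.
Lemma add_Rmax0 : left_id NInf add_Rmax.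
Proof. by case. Qed.

HB.instance Definition _ :=
  GRing.isNmodule.Build (Rmax R) add_RmaxA add_RmaxC add_Rmax0.

Lemma mul_RmaxA : associative mul_Rmax.
Proof. by case=> [|a] [|b] [|c] //=; rewrite addrA. Qed.
Lemma mul_RmaxC : commutative mul_Rmax.
Proof. by case=> [|a] [|b] //=; rewrite addrC. Qed.
Lemma mul_Rmax1 : left_id (Fin 0) mul_Rmax.
Proof. by case=> [|a] //=; rewrite add0r. Qed.
Lemma mul_RmaxDl : left_distributive mul_Rmax +%R.
Proof. by case=> [|a] [|b] [|c] //=; congr Fin; rewrite addr_maxl. Qed.
Lemma mul_Rmax0 : left_zero 0 mul_Rmax.
Proof. by []. Qed.
Lemma one_Rmax_neq0 : Fin 0 != 0 :> Rmax R.
Proof. by apply/eqP. Qed.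

HB.instance Definition _ :=
  GRing.Nmodule_isComNzSemiRing.Build (Rmax R) mul_RmaxA mul_RmaxC mul_Rmax1
    mul_RmaxDl mul_Rmax0 one_Rmax_neq0.
(* Makes {ffun E -> Rmax R} the free module on E with the pointwise action. *)
HB.instance Definition _ := GRing.LSemiModule.copy (Rmax R) (Rmax R)^o.

Lemma scale_RmaxE (a x : Rmax R) : a *: x = a * x.
Proof. by []. Qed.

Lemma le_Rmax_anti : antisymmetric le_Rmax.
Proof. by case=> [|a] [|b] //= ab; congr Fin; apply: le_anti. Qed.
Lemma le_Rmax_trans : transitive le_Rmax.
Proof. by case=> [|a] [|b] [|c] //=; apply: le_trans. Qed.
Lemma le_Rmax_total : total le_Rmax.
Proof. by case=> [|a] [|b] //=; apply: le_total. Qed.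

HB.instance Definition _ :=
  Order.isOrder.Build ring_display (Rmax R)
    (fun _ _ => erefl) (fun _ _ => erefl) (fun _ _ => erefl)
    le_Rmax_anti le_Rmax_trans le_Rmax_total.

(* The order of R U {-oo} is the order x + y = y carried by any module. *)
Lemma le_RmaxE (x y : Rmax R) : (x <= y) = (x + y == y).
Proof.
case: x y => [|a] [|b]; rewrite /Order.le /= /GRing.add /=.
- by rewrite eqxx.
- by rewrite eqxx.
- by apply/esym/eqP.
- apply/idP/eqP => [ab|[/eqP]]; first by rewrite (max_idPr ab).
  by move/eqP/max_idPr.
Qed.

End RmaxInstances.

Section QuotientModule.
Variables (K : pzSemiRingType) (V : lSemiModType K).

(* The smallest module congruence containing S. *)
Inductive cong_gen (S : V -> V -> Prop) : V -> V -> Prop :=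
| cong_base x y : S x y -> cong_gen S x y
| cong_refl x : cong_gen S x x
| cong_sym x y : cong_gen S x y -> cong_gen S y x
| cong_trans x y z : cong_gen S x y -> cong_gen S y z -> cong_gen S x z
| cong_add x y x' y' :
    cong_gen S x y -> cong_gen S x' y' -> cong_gen S (x + x') (y + y')
| cong_scale a x y : cong_gen S x y -> cong_gen S (a *: x) (a *: y).

Variable S : V -> V -> Prop.

Definition cong_rel : rel V := fun x y => `[< cong_gen S x y >].

Lemma cong_rel_refl : reflexive cong_rel.
Proof. by move=> x; apply/asboolP; apply: cong_refl. Qed.
Lemma cong_rel_sym : symmetric cong_rel.
Proof. by move=> x y; apply/asboolP/asboolP; apply: cong_sym. Qed.
Lemma cong_rel_trans : transitive cong_rel.
Proof.
by move=> y x z /asboolP xy /asboolP yz; apply/asboolP/(cong_trans xy yz).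
Qed.

Canonical cong_equiv :=
  EquivRel cong_rel cong_rel_refl cong_rel_sym cong_rel_trans.

Definition quot_mod : Type := {eq_quot cong_equiv}.
HB.instance Definition _ := Choice.on quot_mod.
HB.instance Definition _ := EqQuotient.on quot_mod.

Lemma quot_modP (x y : V) :
  reflect (cong_gen S x y) (\pi_quot_mod x == \pi_quot_mod y).
Proof. by rewrite piE; apply: asboolP. Qed.

Definition quot_zero : quot_mod := \pi_quot_mod (0 : V).
Definition quot_add (p q : quot_mod) : quot_mod := \pi_quot_mod (repr p + repr q).
Definition quot_scale (a : K) (p : quot_mod) : quot_mod := \pi_quot_mod (a *: repr p).

Lemma cong_repr (x : V) : cong_gen S (repr (\pi_quot_mod x)) x.
Proof. by apply/quot_modP; rewrite reprK. Qed.

Lemma quot_addE (x y : V) :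
  quot_add (\pi x) (\pi y) = \pi_quot_mod (x + y).
Proof. by apply/eqP/quot_modP/cong_add; apply: cong_repr. Qed.

Lemma quot_scaleE a (x : V) : quot_scale a (\pi x) = \pi_quot_mod (a *: x).
Proof. by apply/eqP/quot_modP/cong_scale/cong_repr. Qed.

Lemma quot_addA : associative quot_add.
Proof.
by elim/quotW=> x; elim/quotW=> y; elim/quotW=> z; rewrite !quot_addE addrA.
Qed.
Lemma quot_addC : commutative quot_add.
Proof. by elim/quotW=> x; elim/quotW=> y; rewrite !quot_addE addrC. Qed.
Lemma quot_add0 : left_id quot_zero quot_add.
Proof. by elim/quotW=> x; rewrite quot_addE add0r. Qed.

HB.instance Definition _ :=
  GRing.isNmodule.Build quot_mod quot_addA quot_addC quot_add0.

Lemma quot_scaleA a b p :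
  quot_scale a (quot_scale b p) = quot_scale (a * b) p.
Proof. by elim/quotW: p => x; rewrite !quot_scaleE scalerA. Qed.
Lemma quot_scale0 p : quot_scale 0 p = 0.
Proof. by elim/quotW: p => x; rewrite quot_scaleE scale0r. Qed.
Lemma quot_scale1 : left_id 1 quot_scale.
Proof. by elim/quotW=> x; rewrite quot_scaleE scale1r. Qed.
Lemma quot_scaleDr : right_distributive quot_scale +%R.
Proof.
move=> a; elim/quotW=> x; elim/quotW=> y.
by rewrite /GRing.add /= quot_addE !quot_scaleE quot_addE scalerDr.
Qed.
Lemma quot_scaleDl p : {morph quot_scale^~ p : a b / a + b}.
Proof.
elim/quotW: p => x a b.
by rewrite !quot_scaleE [RHS]quot_addE scalerDl.
Qed.

HB.instance Definition _ :=
  GRing.Nmodule_isLSemiModule.Build K quot_mod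
    quot_scaleA quot_scale0 quot_scale1 quot_scaleDr quot_scaleDl.

End QuotientModule.

Section ValuatedMatroid.
Variable R : realType.

Definition supp (E : finType) (X : {ffun E -> Rmax R}) : {set E} :=
  finset (fun e => X e != 0).

Record valuated_matroid (E : finType) := ValuatedMatroid {
  circuit : set {ffun E -> Rmax R};
  circuit_neq0 : ~ circuit 0;
  circuit_incomparable : forall X Y, circuit X -> circuit Y ->
    supp X <> supp Y -> ~~ (supp X \subset supp Y);
  circuit_scale : forall X (a : Rmax R),
    circuit X -> a != 0 -> circuit (a *: X);
  circuit_elim : forall X Y u v, circuit X -> circuit Y ->
    X u = Y u -> X u != 0 -> Y v < X v ->
    exists Z, [/\ circuit Z, Z u = 0, Z v = X v
                & forall e, Z e <= Num.max (X e) (Y e)]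
}.

Definition simple (E : finType) (M : valuated_matroid E) : Prop :=
  forall X, circuit M X -> (3 <= #|supp X|)%N.

Definition basis_elt (E : finType) (y : E) : {ffun E -> Rmax R} :=
  [ffun e => (e == y)%:R].

Definition bend (E : finType) (M : valuated_matroid E)
    (v w : {ffun E -> Rmax R}) : Prop :=
  exists c x, [/\ circuit M c,
    v = \sum_(y : E) c y *: basis_elt y
    & w = \sum_(y : E | y != x) c y *: basis_elt y].

Definition Q (E : finType) (M : valuated_matroid E) : lSemiModType (Rmax R) :=
  quot_mod (bend M).

Definition projectively_equivalent (E E' : finType)
    (M : valuated_matroid E) (M' : valuated_matroid E') : Prop :=
  exists (phi : E -> E') (psi : E' -> E) (s : E -> Rmax R),
    [/\ cancel phi psi, cancel psi phi, forall e, s e != 0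
      & forall eta : {ffun E -> Rmax R},
          circuit M eta <-> circuit M' [ffun y => s (psi y) * eta (psi y)]].

End ValuatedMatroid.

Section RmaxModules.
Variables (R : realType) (N : lSemiModType (Rmax R)).
Implicit Types (x y z : N) (a b : Rmax R).

Definition mod_le x y : Prop := x + y = y.

(* The set written O: { a | a <= 1 }. *)
Definition unit_ball : set (Rmax R) := [set a : Rmax R | a <= 1]%classic.

Definition mod_itv x y : set N := [set z | mod_le x z /\ mod_le z y]%classic.

(* weakly_covers y x and covers y x read: y (weakly) covers x. *)
Definition weakly_covers y x : Prop :=
  mod_le x y /\ forall z, mod_itv x y z -> exists2 a, unit_ball a & z = x + a *: y.

Definition covers y x : Prop :=
  mod_le x y /\ set_bij unit_ball (mod_itv x y) (fun a => x + a *: y).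

Definition atom x : Prop := covers x 0.

Definition atomic : Prop :=
  forall x, exists2 s : seq N, {in s, forall t, atom t} & x = \sum_(t <- s) t.

Definition semimodular : Prop :=
  forall x y z, weakly_covers y x -> weakly_covers (y + z) (x + z).

Definition strongly_torsion_free : Prop :=
  (forall a x, x != 0 -> a != 0 -> a *: x != 0) /\
  (forall x y a b, mod_le x y -> unit_ball a -> unit_ball b ->
     x + a *: y = x + b *: y ->
     a = b \/ (x = x + a *: y /\ x = x + b *: y)).

Definition finitely_generated : Prop :=
  exists (n : nat) (g : 'I_n -> N),
    forall x, exists c : 'I_n -> Rmax R, x = \sum_(i < n) c i *: g i.

End RmaxModules.

Arguments atomic {R} N.
Arguments semimodular {R} N.
Arguments strongly_torsion_free {R} N.
Arguments finitely_generated {R} N.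

Definition isomorphic (K : pzSemiRingType) (V W : lSemiModType K) : Prop :=
  exists f : {linear V -> W}, bijective f.

(* Main.v *)
(* For a valuated matroid M, the relation "[w] <= [v] in Q_M" is decided
   coordinatewise: w(x) x <= [v] iff w(x) <= v(x) or some circuit c satisfies
   c(x) = w(x) and c <= v off x.  Circuit elimination makes this relation
   transitive, and semimodularity and torsion-freeness of Q_M are read off it.

   Conversely, let t be a family of pairwise non-proportional atoms generating N.
   The circuits are the bend vectors of t of minimal support.  The key point is
   that t_e <= sum_y w(y) t_y with w(e) < 1 is always witnessed by such a circuit
   c with c(e) = 1 and c <= w off e: by semimodularity and torsion-freeness each
   coefficient of a support-minimal w can be lowered to a well-defined value.
   This gives both circuit elimination and N = Q_M.  As t is unique up to
   rescaling and reindexing, and determines the circuits, so is M. *)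

From HB Require Import structures.
Require Import Defs.
From mathcomp Require Import all_boot all_order all_algebra.
From mathcomp Require Import generic_quotient.
From mathcomp Require Import boolp classical_sets functions reals.

Set Implicit Arguments.
Unset Strict Implicit.
Unset Printing Implicit Defensive.

Import Order.TTheory GRing.Theory Num.Theory.

Local Open Scope ring_scope.
Local Open Scope quotient_scope.

(** * Order and arithmetic of the max-plus semifield *)

Section RmaxTheory.
Variable R : realType.
Implicit Types a b c : Rmax R.

Lemma Rmax_ge0 a : (0 : Rmax R) <= a.
Proof. by rewrite le_RmaxE add0r. Qed.

Lemma Rmax_le0 a : (a <= 0) = (a == 0).
Proof. by rewrite le_RmaxE addr0. Qed.

Lemma Rmax_gt0 a : ((0 : Rmax R) < a) = (a != 0).
Proof. by rewrite ltNge Rmax_le0. Qed.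

Lemma Rmax_lt_neq0 a b : a < b -> b != 0.
Proof. by move=> ab; rewrite -Rmax_gt0; apply: le_lt_trans ab; apply: Rmax_ge0. Qed.

Lemma add_RmaxE a b : a + b = Num.max a b.
Proof.
case: (leP a b) => [|/ltW]; rewrite le_RmaxE => /eqP //.
by rewrite addrC.
Qed.

Lemma leDl_Rmax a b : a <= a + b.
Proof. by rewrite add_RmaxE le_max lexx. Qed.

Lemma leDr_Rmax a b : b <= a + b.
Proof. by rewrite addrC leDl_Rmax. Qed.

Lemma Rmax_addxx a : a + a = a.
Proof. by rewrite add_RmaxE maxxx. Qed.

Lemma ler_mul_Rmax c a b : a <= b -> c * a <= c * b.
Proof. by rewrite !le_RmaxE -mulrDr => /eqP->. Qed.

Lemma Rmax_inv a : a != 0 -> exists b, a * b = 1 /\ b != 0.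
Proof.
case: a => [|r] // _; exists (Fin (- r)); split => //.
by congr Fin; rewrite subrr.
Qed.

Lemma Rmax_mulf_neq0 a b : a != 0 -> b != 0 -> a * b != 0.
Proof. by case: a b => [|r] // [|s]. Qed.

Lemma Rmax_factor a b : a <= b -> b != 0 -> exists2 c : Rmax R, c <= 1 & a = c * b.
Proof.
move=> ab /Rmax_inv[b' [bb' _]]; exists (b' * a).
  by rewrite -bb' mulrC [b * _]mulrC; rewrite mulrC; apply: ler_mul_Rmax.
by rewrite mulrAC [b' * b]mulrC bb' mul1r.
Qed.

End RmaxTheory.

(** * The order of a module, and chains below weak covers *)

Section ModuleOrder.
Variables (R : realType) (N : lSemiModType (Rmax R)).
Implicit Types (x y z : N) (a b : Rmax R).

Lemma mod_addxx x : x + x = x.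
Proof.
by rewrite -[x in x + _]scale1r -[x in _ + x]scale1r -scalerDl Rmax_addxx scale1r.
Qed.

Lemma mod_lexx x : mod_le x x.
Proof. exact: mod_addxx. Qed.

Lemma mod_le_trans y x z : mod_le x y -> mod_le y z -> mod_le x z.
Proof. by rewrite /mod_le => xy <-; rewrite addrA xy. Qed.

Lemma mod_le_anti x y : mod_le x y -> mod_le y x -> x = y.
Proof. by rewrite /mod_le => xy yx; rewrite -[LHS]yx addrC. Qed.

Lemma mod_ge0 x : mod_le 0 x.
Proof. exact: add0r. Qed.

Lemma mod_leDl x y : mod_le x (x + y).
Proof. by rewrite /mod_le addrA mod_addxx. Qed.

Lemma mod_leDr x y : mod_le y (x + y).
Proof. by rewrite addrC; apply: mod_leDl. Qed.

Lemma mod_leD x y x' y' : mod_le x y -> mod_le x' y' -> mod_le (x + x') (y + y').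
Proof. by rewrite /mod_le => xy xy'; rewrite addrACA xy xy'. Qed.

Lemma mod_leUx x y z : mod_le x z -> mod_le y z -> mod_le (x + y) z.
Proof. by rewrite /mod_le => xz yz; rewrite -addrA yz xz. Qed.

Lemma mod_le_addr z x y : mod_le x y -> mod_le x (y + z).
Proof. by move=> xy; apply: mod_le_trans (mod_leDl _ _). Qed.

Lemma mod_le_sum (I : Type) (r : seq I) (P : pred I) (F : I -> N) z :
  (forall i, P i -> mod_le (F i) z) -> mod_le (\sum_(i <- r | P i) F i) z.
Proof.
move=> Fz; elim/big_ind: _ => // [|u v uz vz]; first exact: mod_ge0.
exact: mod_leUx.
Qed.

Lemma mod_leZ a x y : mod_le x y -> mod_le (a *: x) (a *: y).
Proof. by rewrite /mod_le -scalerDr => ->. Qed.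

Lemma mod_leZl a b x : a <= b -> mod_le (a *: x) (b *: x).
Proof. by rewrite /mod_le le_RmaxE -scalerDl => /eqP->. Qed.

Lemma mod_leZ1 a x : a <= 1 -> mod_le (a *: x) x.
Proof. by move=> /(mod_leZl x); rewrite scale1r. Qed.

Lemma scaler_inj_Rmax a x y : a != 0 -> a *: x = a *: y -> x = y.
Proof.
move=> /Rmax_inv[b [ab _]] /(congr1 ( *:%R b)).
by rewrite !scalerA mulrC ab !scale1r.
Qed.

Lemma scaler_neq0_Rmax a x : a != 0 -> x != 0 -> a *: x != 0.
Proof.
move=> a0; apply: contraNneq => ax; apply/eqP/(scaler_inj_Rmax a0).
by rewrite ax scaler0.
Qed.

(** The interval is parametrised by the totally ordered scalars [a] in [x + a *: y], hence is a
    chain. *)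
Lemma weakly_covers_chain x y p q : weakly_covers y x ->
  mod_itv x y p -> mod_itv x y q -> p + q = p \/ p + q = q.
Proof.
move=> [xy cov] /cov[a _ ->] /cov[b _ ->].
rewrite addrACA mod_addxx -scalerDl add_RmaxE.
by case: leP => _; [right | left].
Qed.

(** All [x + F i] lie in the chain [[x, y]], so their sum is the largest of them; the empty sum
    leaves [x]. *)
Lemma weakly_covers_sum x y (I : finType) (F : I -> N) : weakly_covers y x ->
  y = \sum_i F i -> y = x \/ exists i, y = x + F i.
Proof.
move=> cov yE; have xy : mod_le x y by case: cov.
have Fy i : mod_le (F i) y by rewrite yE (bigD1 i) //=; apply: mod_leDl.
have itvx p : mod_le p y -> mod_itv x y (x + p).
  by move=> py; split; [apply: mod_leDl | apply: mod_leUx].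
suff H (r : seq I) : x + \sum_(i <- r) F i = x \/
    exists i, x + \sum_(i <- r) F i = x + F i.
  by have := H (index_enum I); rewrite -yE xy.
elim: r => [|j r IH]; first by left; rewrite big_nil addr0.
rewrite big_cons; set S := \sum_(i <- r) _ in IH *.
have Sy : mod_le S y by apply: mod_le_sum.
have -> : x + (F j + S) = (x + F j) + (x + S) by rewrite addrACA mod_addxx.
case: (weakly_covers_chain cov (itvx _ (Fy j)) (itvx _ Sy)) => ->.
  by right; exists j.
exact: IH.
Qed.

End ModuleOrder.

(** * Linear combinations and deletion of coordinates *)

Section LinearCombinations.
Variables (R : realType) (N : lSemiModType (Rmax R)) (E : finType).
Implicit Types (t : E -> N) (v w : {ffun E -> Rmax R}).

Definition lincomb t w : N := \sum_y w y *: t y.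

Definition del (x : E) w : {ffun E -> Rmax R} :=
  [ffun y => if y == x then 0 else w y].

Lemma lincombD t v w : lincomb t (v + w) = lincomb t v + lincomb t w.
Proof.
by rewrite /lincomb -big_split; apply: eq_bigr => y _; rewrite ffunE scalerDl.
Qed.

Lemma lincombZ t a w : lincomb t (a *: w) = a *: lincomb t w.
Proof.
by rewrite /lincomb scaler_sumr; apply: eq_bigr => y _; rewrite ffunE scalerA.
Qed.

Lemma lincomb0 t : lincomb t 0 = 0.
Proof. by rewrite /lincomb big1 // => y _; rewrite ffunE scale0r. Qed.

Lemma lincomb_basis t x : lincomb t (basis_elt R x) = t x.
Proof.
rewrite /lincomb (bigD1 x) //= big1 ?addr0 => [|y /negbTE yx].
  by rewrite ffunE eqxx scale1r.
by rewrite ffunE yx scale0r.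
Qed.

Lemma lincomb_delE t x w : lincomb t (del x w) = \sum_(y | y != x) w y *: t y.
Proof.
rewrite /lincomb (bigD1 x) //= ffunE eqxx scale0r add0r.
by apply: eq_bigr => y /negbTE yx; rewrite ffunE yx.
Qed.

Lemma lincomb_del t x w : lincomb t w = w x *: t x + lincomb t (del x w).
Proof. by rewrite lincomb_delE /lincomb (bigD1 x). Qed.

Lemma lincomb_single t w x :
  (forall y, y != x -> w y = 0) -> lincomb t w = w x *: t x.
Proof.
move=> w0; rewrite (lincomb_del t x) [lincomb _ _]big1 ?addr0 // => y _.
by rewrite ffunE; case: eqP => [_|/eqP/w0->]; rewrite scale0r.
Qed.

Lemma lincomb_le t v w : (forall y, v y <= w y) ->
  mod_le (lincomb t v) (lincomb t w).
Proof.
move=> vw; rewrite /mod_le -lincombD; congr lincomb; apply/ffunP => y.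
by rewrite ffunE; apply/eqP; rewrite -le_RmaxE.
Qed.

Lemma lincomb_ge t w y : mod_le (w y *: t y) (lincomb t w).
Proof. by rewrite (lincomb_del t y); apply: mod_leDl. Qed.

Lemma lincomb_lub t w z : (forall y, mod_le (w y *: t y) z) ->
  mod_le (lincomb t w) z.
Proof. by move=> wz; apply: mod_le_sum => y _. Qed.

Lemma ffun_neq0 w : w <> 0 -> exists x, w x != 0.
Proof.
move=> w0; apply: contrapT => /forallNP wz; apply/w0/ffunP => k; rewrite ffunE.
exact/eqP/negPn/negP/wz.
Qed.

Lemma del_le x w y : del x w y <= w y.
Proof. by rewrite ffunE; case: ifP => // _; apply: Rmax_ge0. Qed.

Lemma le_del x v w : (forall y, v y <= w y) -> forall y, del x v y <= del x w y.
Proof. by move=> vw y; rewrite !ffunE; case: ifP. Qed.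

Lemma delC x y w : del x (del y w) = del y (del x w).
Proof. by apply/ffunP => z; rewrite !ffunE; case: ifP; case: ifP. Qed.

Lemma delZ x a w : del x (a *: w) = a *: del x w.
Proof. by apply/ffunP => z; rewrite !ffunE; case: ifP; rewrite ?scaler0. Qed.

Lemma del_proper x w : w x != 0 -> supp (del x w) \proper supp w.
Proof.
move=> wx; apply/properP; split.
  by apply/fintype.subsetP => y; rewrite !inE ffunE; case: ifP; rewrite ?eqxx.
by exists x; rewrite !inE // ffunE eqxx eqxx.
Qed.

End LinearCombinations.

Lemma lincomb_linear (R : realType) (N N' : lSemiModType (Rmax R)) (E : finType)
    (f : {linear N -> N'}) (t : E -> N) w :
  f (lincomb t w) = lincomb (f \o t) w.
Proof.
by rewrite /lincomb linear_sum; apply: eq_bigr => y _; rewrite linearZ.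
Qed.

Lemma lincomb_ffun (R : realType) (E : finType) (w : {ffun E -> Rmax R}) :
  lincomb (@basis_elt R E) w = w.
Proof.
apply/ffunP => x; rewrite /lincomb sum_ffunE (bigD1 x) //= big1 ?addr0.
  by rewrite !ffunE eqxx scale_RmaxE mulr1.
by move=> y /negbTE yx; rewrite !ffunE eq_sym yx scaler0.
Qed.

(** * The module of a valuated matroid: transitivity of [spans] *)

Section MatroidModule.
Variables (R : realType) (E : finType) (M : valuated_matroid R E).
Implicit Types (u v w c d : {ffun E -> Rmax R}) (x y : E) (a b : Rmax R).

(* This encodes the inequality a x <= [v] in Q_M; see scale_basis_le. *)
Definition spans x a v : Prop :=
  a <= v x \/
  exists c, [/\ circuit M c, c x = a & forall y, y != x -> c y <= v y].

(** A witnessing circuit for [b] is rescaled by a/b. The case [a = 0] is separate because circuits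
    may only be rescaled by units. *)
Lemma spans_down x a b v : a <= b -> spans x b v -> spans x a v.
Proof.
move=> ab [bv|[c [Mc cx cv]]]; first by left; apply: le_trans bv.
have [->|a0] := eqVneq a 0; first by left; apply: Rmax_ge0.
have b0 : b != 0 by rewrite -Rmax_gt0 (lt_le_trans _ ab) // Rmax_gt0.
have [r r1 aE] := Rmax_factor ab b0.
right; exists (r *: c); split; first 1 last.
- by rewrite ffunE cx aE.
- move=> y yx; rewrite ffunE; apply: le_trans (cv _ yx).
  by rewrite scale_RmaxE -[leRHS]mul1r ![_ * c y]mulrC; apply: ler_mul_Rmax.
- apply: circuit_scale => //; apply: contraNneq a0 => r0.
  by rewrite aE r0 mul0r.
Qed.

Lemma spans_up x a v w : (forall y, v y <= w y) -> spans x a v -> spans x a w.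
Proof.
move=> vw [av|[c [Mc cx cv]]]; first by left; apply: le_trans (vw x).
by right; exists c; split=> // y yx; apply: le_trans (vw y); apply: cv.
Qed.

(* The coordinates of d that exceed v are eliminated one by one. *)
Lemma spans_circuit x d v : circuit M d ->
  (forall y, y != x -> spans y (d y) v) -> spans x (d x) v.
Proof.
have [n] := ubnP #|[set y | (y != x) && (v y < d y)]%SET|.
elim: n d => // n IH d; rewrite ltnS => dn Md dv.
have [|vdx] := leP (d x) (v x); first by left.
have [/existsP[y /andP[yx vdy]]|/existsPn good] :=
    boolP [exists y, (y != x) && (v y < d y)]; last first.
  by right; exists d; split=> // y yx; move: (good y); rewrite yx /= leNgt.
have [|[c [Mc cy cv]]] := dv y yx; first by rewrite leNgt vdy.
have cx : c x < d x by apply: le_lt_trans vdx; apply: cv; rewrite eq_sym.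
(* Eliminating [y] preserves the [x]-coordinate because [c x <= v x < d x]. *)
have [Z [MZ Zy Zx Zle]] := circuit_elim Md Mc (esym cy) (Rmax_lt_neq0 vdy) cx.
rewrite -Zx; apply: IH => //; last first.
  move=> k kx; have [->|ky] := eqVneq k y; first by left; rewrite Zy Rmax_ge0.
  have := Zle k; rewrite le_max => /orP[Zd|Zc].
    exact: spans_down Zd (dv k kx).
  by left; apply: le_trans Zc (cv k ky).
(* Since [c <= v] off [y], [Z] exceeds [v] only where [d] does, and no longer at [y]. *)
apply: leq_trans dn; apply: proper_card; apply/properP; split; last first.
  by exists y; rewrite !inE ?yx // Zy ltNge Rmax_ge0.
apply/fintype.subsetP => k; rewrite !inE => /andP[-> vZ] /=.
have [ky|ky] := eqVneq k y; first by rewrite ky Zy ltNge Rmax_ge0 in vZ.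
have := lt_le_trans vZ (Zle k); rewrite lt_max => /orP[] //.
by rewrite ltNge cv.
Qed.

Definition spanned w v : Prop := forall x, spans x (w x) v.

Lemma spanned_refl v : spanned v v.
Proof. by move=> x; left. Qed.

Lemma spans_trans x a v w : spans x a v -> spanned v w -> spans x a w.
Proof.
move=> [av|[c [Mc <- cv]]] vw; first exact: spans_down (vw x).
by apply: spans_circuit => // y /cv cvy; apply: spans_down (vw y).
Qed.

Lemma spanned_trans v u w : spanned u v -> spanned v w -> spanned u w.
Proof. by move=> uv vw x; apply: spans_trans (vw). Qed.

Lemma spannedD v w v' w' :
  spanned v w -> spanned v' w' -> spanned (v + v') (w + w').
Proof.
move=> vw vw' x; rewrite ffunE add_RmaxE; case: leP => _.
  by apply: spans_up (vw' x) => y; rewrite ffunE leDr_Rmax.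
by apply: spans_up (vw x) => y; rewrite ffunE leDl_Rmax.
Qed.

Lemma spannedZ a v w : spanned v w -> spanned (a *: v) (a *: w).
Proof.
move=> vw x; have [->|a0] := eqVneq a 0; first by left; rewrite !ffunE !scale0r.
rewrite ffunE; have [vwx|[c [Mc cx cw]]] := vw x.
  by left; rewrite ffunE; apply: ler_mul_Rmax.
right; exists (a *: c); split; first exact: circuit_scale.
  by rewrite ffunE cx.
by move=> y /cw cwy; rewrite !ffunE; apply: ler_mul_Rmax.
Qed.

(** * The order of [Q M] in terms of [spans], and semimodularity *)

Definition qpi w : Q M := \pi_(quot_mod (bend M)) w.

Lemma qpiD v w : qpi (v + w) = qpi v + qpi w.
Proof. by rewrite /qpi -quot_addE. Qed.

Lemma qpiZ a v : qpi (a *: v) = a *: qpi v.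
Proof. by rewrite /qpi -quot_scaleE. Qed.

Lemma qpiP v w : qpi v = qpi w <-> cong_gen (bend M) v w.
Proof. by split=> [/eqP/quot_modP|?]; [|apply/eqP/quot_modP]. Qed.

Lemma qpi_surj (z : Q M) : exists w, z = qpi w.
Proof. by exists (repr z); rewrite /qpi reprK. Qed.

Lemma qpi_bend c x : circuit M c -> qpi c = qpi (del x c).
Proof.
move=> Mc; apply/qpiP/cong_base; exists c, x; split=> //.
  by rewrite -[LHS]lincomb_ffun.
by rewrite -lincomb_delE lincomb_ffun.
Qed.

(** Mutual [spanned] is itself a module congruence, and it contains the bend relations: the circuit
    [c] witnesses the coordinate deleted from it. *)
Lemma cong_spanned v w :
  cong_gen (bend M) v w -> spanned v w /\ spanned w v.
Proof.
elim=> {v w} [v w [c [x [Mc -> ->]]]|v|v w _ []|u v w _ [uv vu] _ [vw wv]||].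
- rewrite -lincomb_delE -/(lincomb _ c) !lincomb_ffun; split=> y; last first.
    by left; apply: del_le.
  have [->|yx] := eqVneq y x; last by left; rewrite ffunE (negbTE yx).
  right; exists c; split=> // z zx.
  by rewrite ffunE (negbTE zx).
- by split; apply: spanned_refl.
- by split.
- by split; [apply: spanned_trans vw | apply: spanned_trans vu].
- by move=> u v u' v' _ [uv vu] _ [uv' vu']; split; apply: spannedD.
- by move=> a u v _ [uv vu]; split; apply: spannedZ.
Qed.

Let basis x : Q M := qpi (basis_elt R x).

Lemma qpi_lincomb w : qpi w = lincomb basis w.
Proof.
rewrite -{1}(lincomb_ffun w) /lincomb.
elim: (index_enum E) => [|x r IH]; first by rewrite !big_nil.
by rewrite !big_cons qpiD qpiZ IH.
Qed.

(** Left to right, [cong_spanned] is applied to [v + w] and [w]. Conversely, a circuit [c] with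
    [c x = v x] gives c(x) x <= [c] = [c without x] <= [w]. *)
Lemma qpi_le v w : mod_le (qpi v) (qpi w) <-> spanned v w.
Proof.
split=> [|vw].
  rewrite /mod_le -qpiD => /qpiP/cong_spanned[vw _] x.
  by apply: spans_down (vw x); rewrite ffunE leDl_Rmax.
rewrite qpi_lincomb; apply: lincomb_lub => x.
have [vwx|[c [Mc <- cw]]] := vw x.
  apply: mod_le_trans (mod_leZl _ vwx) _.
  by rewrite (qpi_lincomb w); apply: lincomb_ge.
apply: (@mod_le_trans _ _ (qpi c)); first by rewrite qpi_lincomb; apply: lincomb_ge.
rewrite (qpi_bend x Mc) !qpi_lincomb; apply: lincomb_le => y.
by rewrite ffunE; case: eqP => [_|/eqP/cw //]; apply: Rmax_ge0.
Qed.

Lemma scale_basis_le x a v : mod_le (a *: basis x) (qpi v) <-> spans x a v.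
Proof.
rewrite -qpiZ; split=> [/qpi_le/(_ x)|av].
  by rewrite !ffunE eqxx scale_RmaxE mulr1.
apply/qpi_le => y; rewrite !ffunE; case: eqP => [->|_].
  by rewrite scale_RmaxE mulr1.
by left; rewrite scaler0 Rmax_ge0.
Qed.

(* A circuit witnessing w <= v + a x through its x-coordinate can be solved
   for x, so that its scaled x-coordinate interpolates between v and v + a x. *)
Lemma weakly_covers_add_basis (z : Q M) x a : weakly_covers (z + a *: basis x) z.
Proof.
split; first exact: mod_leDl.
move=> p [zp pz].
(* With b = r a and r <= 1, z + r (z + a x) equals z + b x. *)
suff [b ba ->] : exists2 b, b <= a & p = z + b *: basis x.
  have [a0|a0] := eqVneq a 0.
    move: ba; rewrite a0 Rmax_le0 => /eqP->; exists 1; first exact: lexx.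
    by rewrite !scale0r !addr0 scale1r mod_addxx.
  have [r r1 ->] := Rmax_factor ba a0; exists r => //.
  by rewrite scalerDr scalerA addrA [z + r *: z]addrC (mod_leZ1 _ r1).
case: (qpi_surj z) zp pz => v ->; case: (qpi_surj p) => w -> zp pz.
have vaE : qpi v + a *: basis x = qpi (v + a *: basis_elt R x).
  by rewrite qpiD qpiZ.
(* One coefficient is found for each coordinate [y] of [w]: b x stays below p, yet z + b x bounds
   w(y) y. The maximum of these coefficients then serves all [y] at once. *)
have step y : exists b, [/\ b <= a, mod_le (b *: basis x) (qpi w)
    & mod_le (w y *: basis y) (qpi v + b *: basis x)].
  have wy : spans y (w y) (v + a *: basis_elt R x).
    by move: pz; rewrite vaE => /qpi_le.
  have trivial_step : mod_le (w y *: basis y) (qpi v) ->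
      exists b, [/\ b <= a, mod_le (b *: basis x) (qpi w)
        & mod_le (w y *: basis y) (qpi v + b *: basis x)].
    move=> wv; exists 0; rewrite scale0r addr0.
    by split; [apply: Rmax_ge0 | apply: mod_ge0 |].
  have vaN k : k != x -> (v + a *: basis_elt R x) k = v k.
    by move=> /negbTE kx; rewrite !ffunE kx scaler0 addr0.
  have vax : (v + a *: basis_elt R x) x = v x + a.
    by rewrite !ffunE eqxx scale_RmaxE mulr1.
  have [yx|yx] := eqVneq y x.
    subst y; case: wy => [|[c [Mc cx cv]]]; last first.
      apply: trivial_step; apply/scale_basis_le.
      by right; exists c; split=> // k kx; rewrite -(vaN k kx) cv.
    rewrite vax add_RmaxE le_max => /orP[wv|wa].
      by apply: trivial_step; apply/scale_basis_le; left.
    exists (w x); split=> //; last by apply: mod_leDr.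
    by rewrite qpi_lincomb; apply: lincomb_ge.
  case: wy => [|[c [Mc cy cv]]].
    by rewrite vaN // => wv; apply: trivial_step; apply/scale_basis_le; left.
  have := cv x; rewrite eq_sym vax add_RmaxE le_max => /(_ yx) /orP[cx|cx].
    apply: trivial_step; apply/scale_basis_le; right; exists c; split=> // k ky.
    by have [->//|kx] := eqVneq k x; rewrite -(vaN k kx) cv.
  have cv' k : k != x -> k != y -> c k <= v k by move=> kx ky; rewrite -vaN // cv.
  (* Bending [c] at [x] gives c(x) x <= z + w(y) y <= p; bending it at [y] gives w(y) y <= z + c(x)
     x. *)
  exists (c x); split=> //.
    apply: (@mod_le_trans _ _ (qpi v + w y *: basis y)); last first.
      by apply: mod_leUx => //; rewrite qpi_lincomb; apply: lincomb_ge.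
    apply: (@mod_le_trans _ _ (qpi (del x c))).
      by rewrite -qpi_bend // qpi_lincomb; apply: lincomb_ge.
    rewrite -qpiZ -qpiD qpi_lincomb [X in mod_le _ X]qpi_lincomb.
    apply: lincomb_le => k; rewrite !ffunE.
    case: eqP => [_|/eqP kx]; first exact: Rmax_ge0.
    have [->|ky] := eqVneq k y; first by rewrite cy scale_RmaxE mulr1 leDr_Rmax.
    by apply: le_trans (cv' k kx ky) _; apply: leDl_Rmax.
  rewrite -[c x *: _]qpiZ -qpiD; apply/scale_basis_le; right; exists c; split=> // k ky.
  rewrite !ffunE; have [->|kx] := eqVneq k x.
    by rewrite scale_RmaxE mulr1 leDr_Rmax.
  by apply: le_trans (cv' k kx ky) _; apply: leDl_Rmax.
have [b bP] := choice step; exists (\sum_y b y).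
  elim/big_ind: _ => [|b1 b2 b1a b2a|y _]; first exact: Rmax_ge0.
    by rewrite add_RmaxE ge_max b1a.
  by case: (bP y).
apply: mod_le_anti.
  rewrite {1}qpi_lincomb; apply: lincomb_lub => y; case: (bP y) => _ _.
  move=> /mod_le_trans; apply; apply: mod_leD; first exact: mod_lexx.
  by apply: mod_leZl; rewrite (bigD1 y) //= leDl_Rmax.
apply: mod_leUx => //; rewrite scaler_suml; apply: mod_le_sum => y _.
by case: (bP y).
Qed.

(** A weak cover of z is z itself or z plus a single multiple of a generator, by
    [weakly_covers_sum]. Adding a further element preserves this shape. *)
Lemma Q_semimodular : semimodular (Q M).
Proof.
move=> z y p cov; have zy : mod_le z y by case: cov.
have [w yE] := qpi_surj y.
have [->|[i ->]] : y = z \/ exists i, y = z + w i *: basis i.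
- by apply: (weakly_covers_sum cov); rewrite yE qpi_lincomb.
- split; first exact: mod_lexx.
  move=> q [pq qp]; exists 1; first exact: lexx.
  by rewrite scale1r mod_addxx; apply: mod_le_anti.
- by rewrite addrAC; apply: weakly_covers_add_basis.
Qed.

(* A circuit through x used to bound a x does not see the x-coordinate. *)
Lemma scale_basis_cancel (z : Q M) x a b : b < a ->
  mod_le (a *: basis x) (z + b *: basis x) -> mod_le (a *: basis x) z.
Proof.
move=> ba; have [v ->] := qpi_surj z; rewrite -[b *: _]qpiZ -qpiD => /scale_basis_le av.
apply/scale_basis_le; case: av => [|[c [Mc cx cv]]].
  rewrite !ffunE eqxx scale_RmaxE mulr1 add_RmaxE le_max => /orP[|]; first by left.
  by rewrite leNgt ba.
right; exists c; split=> // y yx; apply: le_trans (cv y yx) _.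
by rewrite !ffunE (negbTE yx) scaler0 addr0.
Qed.

(** Induction on the support. Write w = w(x) x + w'. As a w(x) < w(x), [scale_basis_cancel] gives
    w(x) x <= z + a w'. Hence w' <= z + a w', so w' <= z by induction, and then w(x) x <= z. *)
Lemma Q_contract (z : Q M) w a : a < 1 ->
  mod_le (qpi w) (z + a *: qpi w) -> mod_le (qpi w) z.
Proof.
move=> a1; have [n] := ubnP #|supp w|.
elim: n w => // n IH w; rewrite ltnS => wn wz.
have [w0|[x]] := set_0Vmem (supp w).
  suff -> : w = 0 by rewrite qpi_lincomb lincomb0; apply: mod_ge0.
  apply/ffunP => y; rewrite ffunE; apply/eqP/negPn.
  by have /setP/(_ y) := w0; rewrite !inE => ->.
rewrite inE => wx.
have awx : a * w x < w x.
  have [b [wb b0]] := Rmax_inv wx.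
  rewrite lt_neqAle; apply/andP; split.
    apply/eqP => /(congr1 ( *%R b)); rewrite mulrCA [b * _]mulrC wb mulr1.
    by move=> aE; rewrite aE ltxx in a1.
  by rewrite mulrC -[leRHS]mulr1; apply: ler_mul_Rmax; apply: ltW.
have wE : qpi w = w x *: basis x + qpi (del x w).
  by rewrite !qpi_lincomb (lincomb_del _ x).
have wxz : mod_le (w x *: basis x) (z + a *: qpi (del x w)).
  apply: (scale_basis_cancel awx).
  rewrite -addrA -scalerA -scalerDr [_ + w x *: _]addrC -wE.
  by apply: mod_le_trans wz; rewrite wE; apply: mod_leDl.
have wz' : mod_le (qpi (del x w)) z.
  apply: IH; first exact: leq_trans (proper_card (del_proper wx)) wn.
  apply: (@mod_le_trans _ _ (qpi w)); first by rewrite wE; apply: mod_leDr.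
  apply: (mod_le_trans wz); rewrite wE scalerDr; apply: mod_leUx; first exact: mod_leDl.
  apply: mod_leUx; last exact: mod_leDr.
  by apply: mod_le_trans wxz; apply: mod_leZ1 (ltW a1).
rewrite wE; apply: mod_leUx => //; apply: (mod_le_trans wxz).
by apply: mod_leUx; [apply: mod_lexx | apply: mod_le_trans (mod_leZ1 _ (ltW a1)) wz'].
Qed.

(** If a < b, write a = r b with r < 1. The equality gives b y <= z + r (b y), and [Q_contract]
    removes the second term. *)
Lemma Q_strongly_torsion_free : strongly_torsion_free (Q M).
Proof.
split=> [a z z0 a0|]; first exact: scaler_neq0_Rmax.
suff lt_case (z y : Q M) a b : a < b -> z + a *: y = z + b *: y -> z = z + b *: y.
  move=> z y a b _ _ _ zE; case: (ltgtP a b) => [ab|ba|->]; last by left.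
    by right; rewrite zE; split; apply: lt_case zE.
  by right; rewrite -zE; split; apply: lt_case (esym zE).
move=> ab zE; have b0 := Rmax_lt_neq0 ab.
have [r r1 aE] := Rmax_factor (ltW ab) b0.
have r1' : r < 1.
  by rewrite lt_neqAle r1 andbT; apply: contraTneq ab => rE; rewrite aE rE mul1r ltxx.
have [w byE] := qpi_surj (b *: y).
rewrite byE addrC; apply/esym; apply: (Q_contract r1').
by rewrite -byE scalerA -aE zE; apply: mod_leDr.
Qed.

(** * Generators of [Q M] as atoms *)

(** A witnessing circuit is supported in {x, y}. Bending it at both points identifies its two terms;
    if x = y it is a loop, and a y = 0. *)
Lemma spans_basis_ray x y a : spans y a (basis_elt R x) ->
  exists2 r : Rmax R, r <= 1 & a *: basis y = r *: basis x.
Proof.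
move=> [|[c [Mc cy cb]]].
  rewrite ffunE; have [->|_] := eqVneq y x; first by exists a.
  by rewrite Rmax_le0 => /eqP->; exists 0; rewrite ?scale0r // Rmax_ge0.
have c0 k : k != y -> k != x -> c k = 0.
  move=> ky kx; apply/eqP; rewrite -Rmax_le0.
  by have := cb k ky; rewrite ffunE (negbTE kx).
have delyE : qpi (del y c) = if x == y then 0 else c x *: basis x.
  rewrite qpi_lincomb (@lincomb_single _ _ _ _ _ x) ?ffunE.
    by case: ifP => //; rewrite scale0r.
  by move=> k kx; rewrite ffunE; case: eqP => // /eqP ky; apply: c0.
move: delyE; have [xy|xy] := eqVneq x y.
  subst y; rewrite -qpi_bend // qpi_lincomb (@lincomb_single _ _ _ _ _ x) ?cy; last first.
    by move=> k kx; apply: c0.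
  by move=> ->; exists 0; rewrite ?scale0r // Rmax_ge0.
rewrite -(qpi_bend y Mc) (qpi_bend x Mc) qpi_lincomb (@lincomb_single _ _ _ _ _ y).
  rewrite ffunE eq_sym (negbTE xy) cy => ->; exists (c x) => //.
  by have := cb x xy; rewrite ffunE eqxx.
by move=> k ky; rewrite ffunE; case: eqP => // /eqP kx; apply: c0.
Qed.

Lemma basis_ray x (z : Q M) : mod_le z (basis x) ->
  exists2 r : Rmax R, r <= 1 & z = r *: basis x.
Proof.
have [w -> /qpi_le wx] := qpi_surj z.
rewrite qpi_lincomb /lincomb.
elim/big_ind: _ => [|_ _ [a a1 ->] [b b1 ->]|y _].
- by exists 0; rewrite ?scale0r // Rmax_ge0.
- by exists (a + b); rewrite ?scalerDl // add_RmaxE ge_max a1.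
- exact: spans_basis_ray.
Qed.

(** If a < b, then b x <= 0 + a x, and cancellation would give b x <= 0. *)
Lemma basis_scale_inj x a b : basis x != 0 -> a *: basis x = b *: basis x -> a = b.
Proof.
move=> x0; suff lt_case a' b' : a' < b' -> a' *: basis x = b' *: basis x -> False.
  by case: (ltgtP a b) => // [/lt_case H /H|/lt_case H /esym/H].
move=> ab /esym xE; case/eqP: x0; apply: (scaler_inj_Rmax (Rmax_lt_neq0 ab)).
rewrite scaler0; apply: mod_le_anti; last exact: mod_ge0.
by apply: (scale_basis_cancel ab); rewrite add0r xE; apply: mod_lexx.
Qed.

Lemma basis_atom x : basis x != 0 -> atom (basis x).
Proof.
move=> x0; split; first exact: mod_ge0.
split=> [a a1|a b _ _|z [_ /basis_ray[r r1 ->]]].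
- by rewrite add0r; split; [apply: mod_ge0 | apply: mod_leZ1].
- by rewrite !add0r; apply: basis_scale_inj.
- by exists r; rewrite ?add0r.
Qed.

End MatroidModule.

Lemma atom_scale (R : realType) (N : lSemiModType (Rmax R)) a (z : N) :
  a != 0 -> atom z -> atom (a *: z).
Proof.
move=> a0 [_ [_ inj surj]]; have [b [ab b0]] := Rmax_inv a0.
split; first exact: mod_ge0.
split=> [r r1|r s r1 s1|p [_ pz]].
- by rewrite add0r; split; [apply: mod_ge0 | apply: mod_leZ1].
- rewrite !add0r !scalerA mulrC [s * a]mulrC -!scalerA => /(scaler_inj_Rmax a0) E.
  by apply: inj => //; rewrite !add0r.
- have [|r r1] := surj (b *: p).
    split; first exact: mod_ge0.
    by have := mod_leZ b pz; rewrite scalerA mulrC ab scale1r.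
  rewrite add0r => E; exists r => //.
  by rewrite add0r scalerA mulrC -scalerA E scalerA ab scale1r.
Qed.

Lemma Q_atomic (R : realType) (E : finType) (M : valuated_matroid R E) : atomic (Q M).
Proof.
move=> z; have [w ->] := qpi_surj z.
rewrite qpi_lincomb /lincomb.
(* Zero terms, coming from loops or zero coefficients, are not atoms and must be dropped. *)
exists [seq w y *: qpi M (basis_elt R y) | y <- index_enum E
          & w y *: qpi M (basis_elt R y) != 0].
  move=> t /mapP[y]; rewrite mem_filter => /andP[wy0 _] ->.
  apply: atom_scale; first by apply: contraNneq wy0 => ->; rewrite scale0r.
  by apply: basis_atom; apply: contraNneq wy0 => ->; rewrite scaler0.
rewrite big_map big_filter [RHS]big_mkcond; apply: eq_bigr => y _.
by case: eqP.
Qed.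

(** * Elementary vectors in a strongly torsion-free module *)

Section ElementaryVectors.
Variables (R : realType) (N : lSemiModType (Rmax R)).
Hypothesis stfN : strongly_torsion_free N.

(** Torsion-freeness is applied to z <= z + b p with the coefficients r = a/b and 1: both z + r (z +
    b p) and z + (z + b p) equal z + b p. As r < 1, this forces z = z + b p. *)
Lemma stf_cancel (a b : Rmax R) (z p : N) : a < b ->
  mod_le (b *: p) (z + a *: p) -> mod_le (b *: p) z.
Proof.
move=> ab bp; have b0 := Rmax_lt_neq0 ab.
have [r r1 aE] := Rmax_factor (ltW ab) b0.
have zE : z + r *: (z + b *: p) = z + 1 *: (z + b *: p).
  rewrite scale1r scalerDr scalerA -aE addrA [z + r *: z]addrC (mod_leZ1 _ r1).
  rewrite addrA mod_addxx; apply: mod_le_anti.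
    by apply: mod_leD; [apply: mod_lexx | apply/mod_leZl/ltW].
  by apply: mod_leUx => //; apply: mod_leDl.
have [r1E|[_ zE']] := stfN.2 _ _ _ _ (mod_leDl z (b *: p)) r1 (lexx _) zE.
  by rewrite aE r1E mul1r ltxx in ab.
by rewrite zE' scale1r addrA mod_addxx; apply: mod_leDr.
Qed.

Section Family.
Variables (E : finType) (t : E -> N).
Implicit Types (c v w : {ffun E -> Rmax R}).

Definition bend_vector c : Prop := forall x, lincomb t (del x c) = lincomb t c.

(* By elementary_unique, these are the bend vectors of minimal support. *)
Definition elementary c : Prop :=
  [/\ c <> 0, bend_vector c & forall x y, x != y -> c x != 0 -> c y != 0 ->
        lincomb t (del x (del y c)) <> lincomb t c].

Lemma elementary_scale a c : a != 0 -> elementary c -> elementary (a *: c).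
Proof.
move=> a0 [c0 cb ce]; split.
- by move=> ac; apply/c0/(scaler_inj_Rmax a0); rewrite ac scaler0.
- by move=> x; rewrite delZ !lincombZ cb.
- move=> x y xy; rewrite !ffunE => cx cy.
  rewrite !delZ !lincombZ => /(scaler_inj_Rmax a0); apply: ce => //.
    by apply: contraNneq cx => ->; rewrite scaler0.
  by apply: contraNneq cy => ->; rewrite scaler0.
Qed.

Lemma bend_vector_le c x : bend_vector c ->
  mod_le (c x *: t x) (lincomb t (del x c)).
Proof. by move=> ->; apply: lincomb_ge. Qed.

(* Compare c' with the smallest multiple of c above it; they agree somewhere. *)
Lemma elementary_unique c c' : elementary c -> bend_vector c' -> c' <> 0 ->
  supp c' \subset supp c -> exists2 r, r != 0 & c' = r *: c.
Proof.
move=> ec bc' c'0 /fintype.subsetP sub.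
(* [q] is the ratio c'/c. Its value 0 off the support of [c] ensures that the nonzero maximum is
   attained inside the support. *)
have /choice[q qP] : forall k, exists r, c' k = r * c k /\ (c k = 0 -> r = 0).
  move=> k; have [ck|ck] := eqVneq (c k) 0.
    exists 0; split=> //; rewrite mul0r; apply/eqP/negPn/negP => c'k.
    by have := sub k; rewrite !inE ck eqxx c'k => /(_ isT).
  have [b [bc _]] := Rmax_inv ck; exists (c' k * b).
  by rewrite -mulrA [b * _]mulrC bc mulr1; split=> // ck0; rewrite ck0 eqxx in ck.
have cE k : c' k = q k * c k by case: (qP k).
have [k0 c'k0] := ffun_neq0 c'0.
pose y := [arg max_(k > k0) q k]%O.
have qy k : q k <= q y by rewrite /y; case: arg_maxP => // i _; apply.
have qy0 : q y != 0.
  apply: contraNneq c'k0 => qy0; rewrite cE.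
  by have := qy k0; rewrite qy0 Rmax_le0 => /eqP->; rewrite mul0r.
exists (q y) => //.
have [_ db de] := elementary_scale qy0 ec; set d := q y *: c in db de *.
have c'd k : c' k <= d k.
  by rewrite cE ffunE scale_RmaxE ![_ * c k]mulrC; apply: ler_mul_Rmax.
have c'y : c' y = d y by rewrite cE ffunE.
apply/ffunP => x; apply/eqP; rewrite eq_le c'd /= leNgt; apply/negP => c'x.
have xy : x != y by apply: contraTneq c'x => ->; rewrite c'y ltxx.
have dx0 := Rmax_lt_neq0 c'x.
have dy0 : d y != 0.
  rewrite ffunE scale_RmaxE Rmax_mulf_neq0 //.
  by apply: contraNneq qy0 => cy; case: (qP y) => _ /(_ cy)->.
pose z := lincomb t (del x (del y d)).
(* Bending [d] at [x] and then [c'] at [y], where the two agree, gives d(x) t_x <= z + c'(x) t_x;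
   the last term cancels. So deleting both [x] and [y] from [d] would not change its combination,
   against elementarity. *)
have dxz : mod_le (d x *: t x) z.
  apply: (stf_cancel c'x); apply: mod_le_trans (lincomb_ge t d x) _.
  rewrite -(db x) (lincomb_del t y) delC -/z.
  rewrite [del x d y]ffunE eq_sym (negbTE xy) -c'y.
  apply: mod_leUx; last exact: mod_leDl.
  apply: mod_le_trans (bend_vector_le y bc') _.
  rewrite (lincomb_del t x) addrC ffunE (negbTE xy).
  apply: mod_leD; last exact: mod_lexx.
  by apply: lincomb_le; apply: le_del; apply: le_del.
apply: (de x y xy dx0 dy0); apply: mod_le_anti.
  by apply: lincomb_le => k; apply: le_trans (del_le _ _ _) (del_le _ _ _).
rewrite -(db y) (lincomb_del t x) ffunE (negbTE xy).
by apply: mod_leUx => //; apply: mod_lexx.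
Qed.

End Family.

(** * The matroid of elementary vectors for a family of atoms *)

Section Semimodular.
Variables (E : finType) (t : E -> N).
Hypotheses (smN : semimodular N) (t_atom : forall x, atom (t x)).
Implicit Types (c v w : {ffun E -> Rmax R}).

(** For [a != 0], a t_y weakly covers 0, so by semimodularity z + a t_y weakly covers z, and z + p
    lies between them. *)
Lemma exchange (z p : N) (a : Rmax R) y : mod_le p (z + a *: t y) ->
  exists2 b, b <= a & z + p = z + b *: t y.
Proof.
move=> pz; have [a0|a0] := eqVneq a 0.
  exists 0; first exact: Rmax_ge0.
  move: pz; rewrite a0 !scale0r !addr0 => pz.
  by apply: mod_le_anti; [apply: mod_leUx => //; apply: mod_lexx | apply: mod_leDl].
have [_ [_ _ surj]] := atom_scale a0 (t_atom y).
have /(@smN _ _ z) : weakly_covers (a *: t y) 0.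
  split; first exact: mod_ge0.
  by move=> q /surj[r r1 <-]; exists r.
rewrite add0r => -[_ /(_ (z + p))] [|r r1 ->].
  split; first exact: mod_leDl.
  by rewrite addrC; apply: mod_leUx => //; rewrite ?[_ + z]addrC //; apply: mod_leDl.
exists (r * a); last first.
  by rewrite [_ + z]addrC scalerDr scalerA addrA [z + r *: z]addrC (mod_leZ1 _ r1).
by rewrite mulrC -[leRHS]mulr1; apply: ler_mul_Rmax.
Qed.

(* With w of minimal support, each coordinate of w can be lowered to the unique
   value bf y for which z + b t_e = z + bf y t_y, where z is the combination of
   the other coordinates.  Lowering one coordinate does not change these values
   for the others, so they can all be lowered, and the result is elementary. *)
Lemma elementary_le_disjoint w e (b : Rmax R) : b != 0 -> w e = 0 ->
  mod_le (b *: t e) (lincomb t w) ->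
  exists c, [/\ elementary t c, c e = b & forall y, y != e -> c y <= w y].
Proof.
move=> b0; have [n] := ubnP #|supp w|.
elim: n w => // n IH w; rewrite ltnS => wn we pw.
set p := b *: t e in pw *.
have [[y [wy0 py]]|/forallNP minw] :=
    pselect (exists y, w y != 0 /\ mod_le p (lincomb t (del y w))).
  have [||//|c [ec ce cw]] := IH (del y w).
  - exact: leq_trans (proper_card (del_proper wy0)) wn.
  - by rewrite ffunE we; case: ifP.
  - by exists c; split=> // k ke; apply: le_trans (cw k ke) (del_le _ _ _).
have low v y : mod_le p (lincomb t v) -> exists b' : Rmax R, b' <= v y /\
    lincomb t (del y v) + p = lincomb t (del y v) + b' *: t y.
  by rewrite (lincomb_del t y) addrC => /exchange[b' b'v E']; exists b'.
have /choice[bf bfP] := fun y => low w y pw.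
have bf0 y : w y = 0 -> bf y = 0.
  by move=> wy; apply/eqP; rewrite -Rmax_le0 -wy; case: (bfP y).
(* Of two distinct admissible values the larger could be cancelled, leaving [p] below the
   combination without [y], against minimality of the support. *)
have uniq_bf y b' : w y != 0 ->
    lincomb t (del y w) + p = lincomb t (del y w) + b' *: t y -> b' = bf y.
  have [_ bfE] := bfP y; move=> wy0 b'E.
  have lt_case b1 b2 : lincomb t (del y w) + p = lincomb t (del y w) + b1 *: t y ->
      lincomb t (del y w) + p = lincomb t (del y w) + b2 *: t y -> ~ b1 < b2.
    move=> b1E b2E b12; apply: (minw y); split=> //.
    have /(stf_cancel b12) b2z :
        mod_le (b2 *: t y) (lincomb t (del y w) + b1 *: t y).
      by rewrite -b1E b2E; apply: mod_leDr.
    apply: (@mod_le_trans _ _ (lincomb t (del y w) + p)); first exact: mod_leDr.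
    by rewrite b2E; apply: mod_leUx => //; apply: mod_lexx.
  by case: (ltgtP b' (bf y)) => // [/(lt_case _ _ b'E bfE)|/(lt_case _ _ bfE b'E)].
(* A value that works for [v <= w] also works for [w], on adding the combination of [w] off [y]; by
   uniqueness it is [bf y]. *)
have lower v y : (forall k, v k <= w k) -> mod_le p (lincomb t v) ->
    lincomb t (del y v) + p = lincomb t (del y v) + bf y *: t y.
  move=> vw pv; have [b' [b'v b'E]] := low v y pv.
  have [wy|wy] := eqVneq (w y) 0.
    move: b'E; rewrite (bf0 _ wy).
    by have := le_trans b'v (vw y); rewrite wy Rmax_le0 => /eqP->.
  rewrite b'E (uniq_bf y b') //.
  have zvw : mod_le (lincomb t (del y v)) (lincomb t (del y w)).
    exact/lincomb_le/le_del.
  by rewrite -zvw [_ + lincomb t (del y w)]addrC -!addrA b'E.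
pose c0 : {ffun E -> Rmax R} := [ffun y => bf y].
have c0w y : c0 y <= w y by rewrite ffunE; case: (bfP y).
have pc0 : mod_le p (lincomb t c0).
  (* The coordinates are lowered one at a time along a list. *)
  suff lowered (r : seq E) :
      mod_le p (lincomb t [ffun y => if y \in r then bf y else w y]).
    have := lowered (enum E); congr (mod_le p (lincomb t _)).
    by apply/ffunP => y; rewrite !ffunE mem_enum.
  elim: r => [|y r pr].
    by move: pw; congr (mod_le p (lincomb t _)); apply/ffunP => y; rewrite ffunE.
  set v := finfun _ in pr; set v' := finfun _.
  have vw k : v k <= w k by rewrite ffunE; case: ifP => // _; case: (bfP k).
  have -> : lincomb t v' = lincomb t (del y v) + p.
    rewrite lower // (lincomb_del t y) addrC; congr (lincomb t _ + _ *: _).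
      by apply/ffunP => k; rewrite !ffunE inE; case: (eqVneq k y).
    by rewrite ffunE inE eqxx.
  exact: mod_leDr.
have c0e : c0 e = 0 by rewrite ffunE bf0.
pose c : {ffun E -> Rmax R} := [ffun y => if y == e then b else bf y].
have cE y : y != e -> c y = c0 y by rewrite !ffunE => /negbTE->.
have ce : c e = b by rewrite ffunE eqxx.
have delec : del e c = c0.
  by apply/ffunP => k; rewrite ffunE; case: eqP => [->|/eqP/cE].
have lcc0 : lincomb t c = lincomb t c0 by rewrite (lincomb_del t e) ce delec.
have delec' y : y != e -> lincomb t (del y c) = p + lincomb t (del y c0).
  move=> ye; rewrite (lincomb_del t e) delC delec.
  by rewrite ffunE eq_sym (negbTE ye) ce.
have lowc0 y : lincomb t (del y c0) + p = lincomb t c0.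
  by rewrite lower // [RHS](lincomb_del t y) addrC ffunE.
have notp y : y != e -> c y != 0 -> ~ mod_le p (lincomb t (del y c0)).
  move=> ye cy0 py; apply: (minw y); split.
    by apply: contraNneq cy0 => wy; rewrite cE // -Rmax_le0 -wy.
  by apply: mod_le_trans py _; apply/lincomb_le/le_del.
exists c; split=> //; last by move=> y ye; rewrite cE.
split.
- by move=> cz; move: b0; rewrite -ce cz ffunE eqxx.
- move=> x; have [->|xe] := eqVneq x e; first by rewrite delec.
  by rewrite delec' // addrC lowc0.
move=> x y xy cx cy; have [xe|xe] := eqVneq x e.
  subst x; rewrite delC delec lcc0 => zE; apply: (notp y) => //; first by rewrite eq_sym.
  by rewrite zE.
have [ye|ye] := eqVneq y e.
  by subst y; rewrite delec lcc0 => zE; apply: (notp x) => //; rewrite zE.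
pose z := lincomb t (del x (del y c0)).
have -> : lincomb t (del x (del y c)) = z + p.
  rewrite (lincomb_del t e) addrC !ffunE ![e == _]eq_sym (negbTE xe) (negbTE ye) eqxx.
  by congr (lincomb t _ + _); rewrite delC [del e _]delC delec.
rewrite lcc0 => zp.
have zx : lincomb t (del y c0) = z + c0 x *: t x.
  by rewrite (lincomb_del t x) addrC ffunE (negbTE xy).
have zy : lincomb t (del x c0) = z + c0 y *: t y.
  by rewrite (lincomb_del t y) addrC delC ffunE eq_sym (negbTE xy).
(* Modulo z, the terms at [x] and [y] both become multiples of t_e. The larger multiple alone
   already bounds [p], so [x] or [y] could be dropped, against minimality. *)
have [mu _ muE] : exists2 b', b' <= b & z + c0 x *: t x = z + b' *: t e.
  by apply: exchange; rewrite zp; apply: lincomb_ge.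
have [nu _ nuE] : exists2 b', b' <= b & z + c0 y *: t y = z + b' *: t e.
  by apply: exchange; rewrite zp; apply: lincomb_ge.
have : mod_le p (z + (mu + nu) *: t e).
  apply: (mod_le_trans pc0).
  rewrite scalerDl -[z]mod_addxx addrACA -muE -nuE -zy (lincomb_del t x).
  by apply: mod_leD; [apply: mod_leDr | apply: mod_lexx].
rewrite add_RmaxE; case: leP => _.
  by rewrite -nuE -zy; apply: notp.
by rewrite -muE -zx; apply: notp.
Qed.

(** The [e]-coordinate of [w] is below [b], so it cancels and the disjoint case applies. *)
Lemma elementary_le w e (b : Rmax R) : w e < b ->
  mod_le (b *: t e) (lincomb t w) ->
  exists c, [/\ elementary t c, c e = b & forall y, y != e -> c y <= w y].
Proof.
move=> web; rewrite (lincomb_del t e) addrC => /(stf_cancel web) bw.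
have [|c [ec ce cw]] := elementary_le_disjoint (Rmax_lt_neq0 web) _ bw.
  by rewrite ffunE eqxx.
by exists c; split=> // y ye; apply: le_trans (cw y ye) (del_le _ _ _).
Qed.

Lemma elementary_incomparable c c' : elementary t c -> elementary t c' ->
  supp c <> supp c' -> ~~ (supp c \subset supp c').
Proof.
move=> [c0 cb _] ec' cc'; apply/negP => /(elementary_unique ec' cb c0)[r r0 cE].
apply/cc'/setP => y; rewrite !inE cE ffunE.
have [->|c'y] := eqVneq (c' y) 0; first by rewrite scaler0 eqxx.
by rewrite Rmax_mulf_neq0.
Qed.

(** Bend [c] at [y] and replace its [x]-term, shared with [d], by bending [d] at [x]. The resulting
    term d(y) t_y cancels against c(y) t_y, which is thus bounded by c + d off x and y;
    [elementary_le] turns this bound into a vector. *)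
Lemma elementary_elim c d x y : elementary t c -> elementary t d ->
  c x = d x -> c x != 0 -> d y < c y ->
  exists e, [/\ elementary t e, e x = 0, e y = c y
              & forall k, e k <= Num.max (c k) (d k)].
Proof.
move=> [_ cb _] [_ db _] cdx cx0 dcy.
have xy : x != y by apply: contraTneq dcy => <-; rewrite cdx ltxx.
pose w := del x (del y (c + d)).
have cdw k : (c + d) k = Num.max (c k) (d k) by rewrite ffunE add_RmaxE.
have cw : mod_le (c y *: t y) (lincomb t w).
  apply: (stf_cancel dcy); apply: mod_le_trans (bend_vector_le y cb) _.
  rewrite (lincomb_del t x) ffunE (negbTE xy) cdx; apply: mod_leUx.
    apply: mod_le_trans (bend_vector_le x db) _.
    rewrite (lincomb_del t y) ffunE eq_sym (negbTE xy) addrC delC.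
    apply: mod_leD; last exact: mod_lexx.
    by apply/lincomb_le/le_del/le_del => k; rewrite ffunE leDr_Rmax.
  apply: mod_le_addr; apply/lincomb_le/le_del/le_del => k.
  by rewrite ffunE leDl_Rmax.
have [|e [ee ey ew]] := elementary_le _ cw.
  by rewrite !ffunE eqxx if_same Rmax_gt0 (Rmax_lt_neq0 dcy).
exists e; split=> //.
  by apply/eqP; rewrite -Rmax_le0; have := ew x xy; rewrite ffunE eqxx.
move=> k; have [->|ky] := eqVneq k y; first by rewrite ey le_max lexx.
by rewrite -cdw; apply: le_trans (ew k ky) (le_trans (del_le _ _ _) (del_le _ _ _)).
Qed.

Definition elementary_matroid : valuated_matroid R E :=
  @ValuatedMatroid R E (elementary t)
    (fun e0 => let: And3 n0 _ _ := e0 in n0 erefl)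
    elementary_incomparable
    (fun c a ec a0 => elementary_scale a0 ec)
    elementary_elim.

(** Coordinatewise, [elementary_le] supplies the circuits required by [spans]; conversely each such
    circuit is a bend vector, which yields the inequality in N. *)
Lemma elementary_matroid_le v w :
  mod_le (lincomb t v) (lincomb t w) <->
  mod_le (qpi elementary_matroid v) (qpi elementary_matroid w).
Proof.
split=> [vw|/qpi_le vw].
  apply/qpi_le => x; have [vwx|wvx] := leP (v x) (w x); first by left.
  right; apply: (elementary_le wvx); apply: mod_le_trans vw.
  exact: lincomb_ge.
apply: lincomb_lub => x; have [vwx|[c [[_ cb _] <- cw]]] := vw x.
  exact: mod_le_trans (mod_leZl _ vwx) (lincomb_ge _ _ _).
apply: mod_le_trans (bend_vector_le x cb) _; apply: lincomb_le => y.
by rewrite ffunE; case: eqP => [_|/eqP/cw //]; apply: Rmax_ge0.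
Qed.

Lemma elementary_matroid_eq v w : lincomb t v = lincomb t w <->
  qpi elementary_matroid v = qpi elementary_matroid w.
Proof.
by split=> vw; apply: mod_le_anti; apply/elementary_matroid_le;
  rewrite vw; apply: mod_lexx.
Qed.

(** Coefficient vectors have the same combination exactly when they have the same class, so any
    choice [g] of coefficients induces a linear map. *)
Lemma elementary_matroid_iso : (forall z, exists w, z = lincomb t w) ->
  isomorphic N (Q elementary_matroid).
Proof.
move=> /choice[g gP]; pose f z := qpi elementary_matroid (g z).
have fP w z : f z = qpi elementary_matroid w <-> z = lincomb t w.
  by rewrite [in X in _ <-> X](gP z); split=> /elementary_matroid_eq.
have fS a : {morph f : z / a *: z}.
  by move=> z; rewrite -qpiZ; apply/fP; rewrite lincombZ -gP.
have fD : {morph f : z p / z + p}.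
  by move=> z p; rewrite -qpiD; apply/fP; rewrite lincombD -!gP.
pose fL : {linear N -> Q elementary_matroid} :=
  HB.pack f (GRing.isSemilinear.Build _ _ _ _ f (fS, fD)).
exists fL, (fun q => lincomb t (repr q)) => [z|q].
  rewrite [RHS]gP; apply/elementary_matroid_eq.
  by rewrite /qpi reprK.
by have [w ->] := qpi_surj q; apply/fP/elementary_matroid_eq; rewrite /qpi reprK.
Qed.

End Semimodular.

(** A bend vector supported on one point would make a generator zero; one supported on two points
    would make two generators proportional. *)
Lemma elementary_supp_ge3 (E : finType) (t : E -> N) c :
  (forall x, t x != 0) -> (forall x y r, t x = r *: t y -> x = y) ->
  elementary t c -> (3 <= #|supp c|)%N.
Proof.
move=> t0 t_indep [c0 cb _].
have [x cx] := ffun_neq0 c0.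
have lc0 : lincomb t c != 0.
  apply: contraNneq (scaler_neq0_Rmax cx (t0 x)) => lc0; apply/eqP.
  by apply: mod_le_anti; [rewrite -lc0; apply: lincomb_ge | apply: mod_ge0].
have [y [yx cy]] : exists y, y != x /\ c y != 0.
  apply: contrapT => /forallNP cz; case/eqP: lc0.
  rewrite -(cb x) (@lincomb_single _ _ _ t _ x) ?ffunE ?eqxx ?scale0r // => y yx.
  rewrite ffunE (negbTE yx); apply/eqP/negPn/negP => cy.
  by apply: (cz y).
have [[z [zx zy cz]]|/forallNP cz] := pselect (exists z, [/\ z != x, z != y & c z != 0]).
  have sub : [set x; y; z]%SET \subset supp c.
    by apply/fintype.subsetP => k; rewrite !inE => /orP[/orP[]|] /eqP->.
  apply: leq_trans (subset_leq_card sub).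
  rewrite -finset.setUA cardsU1 cards2 !inE.
  by rewrite ![x == _]eq_sym [y == z]eq_sym (negbTE yx) (negbTE zx) zy.
have cz0 k : k != x -> k != y -> c k = 0.
  by move=> kx ky; apply/eqP/negPn/negP => ck; apply: (cz k).
have delx : lincomb t (del x c) = c y *: t y.
  rewrite (@lincomb_single _ _ _ t _ y) ?ffunE ?(negbTE yx) // => k ky.
  by rewrite ffunE; case: eqP => // /eqP kx; apply: cz0.
have dely : lincomb t (del y c) = c x *: t x.
  rewrite (@lincomb_single _ _ _ t _ x) ?ffunE 1?eq_sym ?(negbTE yx) // => k kx.
  by rewrite ffunE; case: eqP => // /eqP ky; apply: cz0.
have [b [cxb _]] := Rmax_inv cx.
case/eqP: yx; apply/esym/(t_indep _ _ (b * c y)).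
by rewrite -scalerA -delx cb -(cb y) dely scalerA mulrC cxb scale1r.
Qed.

End ElementaryVectors.

(** * Recovering the circuits from the module *)

(** If a circuit were not elementary, [scale_basis_le] would give a circuit of strictly smaller
    support. Conversely, the support of an elementary vector contains that of a circuit, and
    [elementary_unique] makes the two proportional. *)
Lemma circuit_elementary (R : realType) (E : finType) (M : valuated_matroid R E) c :
  circuit M c <-> elementary (fun x => qpi M (basis_elt R x)) c.
Proof.
set t := (fun x => _).
have Mc_bend d : circuit M d -> bend_vector t d.
  by move=> Md x; rewrite -!qpi_lincomb -qpi_bend.
have Mc0 d : circuit M d -> d <> 0.
  by move=> Md d0; apply: (@circuit_neq0 _ _ M); rewrite -d0.
split=> [Mc|ec]; last first.
  have [c0 cb _] := ec.
  have [x cx] := ffun_neq0 c0.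
  have := bend_vector_le x cb; rewrite -qpi_lincomb => /scale_basis_le[|[d [Md dx dc]]].
    by rewrite ffunE eqxx Rmax_le0 (negbTE cx).
  have dsub : supp d \subset supp c.
    apply/fintype.subsetP => k; rewrite !inE; apply: contraNneq => ck.
    rewrite -Rmax_le0; have [kx|kx] := eqVneq k x.
      by rewrite -kx ck eqxx in cx.
    by apply: le_trans (dc k kx) _; rewrite ffunE (negbTE kx) ck.
  have [r r0 dE] := elementary_unique (Q_strongly_torsion_free M) ec
    (Mc_bend _ Md) (Mc0 _ Md) dsub.
  have [b [rb b0]] := Rmax_inv r0.
  have -> : c = b *: d by rewrite dE scalerA mulrC rb scale1r.
  exact: circuit_scale.
split; [exact: Mc0 | exact: Mc_bend |].
move=> x y xy cx cy; rewrite -!qpi_lincomb => delE.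
have : spans M x (c x) (del x (del y c)).
  by apply/scale_basis_le; rewrite delE [X in mod_le _ X]qpi_lincomb; apply: lincomb_ge.
move=> [|[d [Md dx dc]]]; first by rewrite ffunE eqxx Rmax_le0 (negbTE cx).
have dlec k : d k <= c k.
  have [->|kx] := eqVneq k x; first by rewrite dx.
  exact: le_trans (dc k kx) (le_trans (del_le _ _ _) (del_le _ _ _)).
have dy : d y = 0.
  apply/eqP; rewrite -Rmax_le0; have := dc y; rewrite eq_sym => /(_ xy).
  by rewrite !ffunE eqxx if_same.
have dc_neq : supp d <> supp c.
  by move=> /setP/(_ y); rewrite !inE dy eqxx cy.
have /negP := circuit_incomparable Md Mc dc_neq; apply.
apply/fintype.subsetP => k; rewrite !inE; apply: contraNneq => ck.
by rewrite -Rmax_le0 -ck.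
Qed.

(** If x and y differed, a witnessing circuit would have support inside {x, y}, too small for a
    simple matroid. *)
Lemma simple_basis (R : realType) (E : finType) (M : valuated_matroid R E)
    (x y : E) (a : Rmax R) : simple M ->
  mod_le (qpi M (basis_elt R x)) (a *: qpi M (basis_elt R y)) -> x = y.
Proof.
move=> sM; rewrite -[qpi M (basis_elt R x)]scale1r -qpiZ => /scale_basis_le xay.
apply/eqP/negPn/negP => xy; case: xay => [|[c [Mc cx ca]]].
  by rewrite !ffunE (negbTE xy) scaler0 Rmax_le0.
have : (#|supp c| <= #|[set x; y]%SET|)%N.
  apply/subset_leq_card/fintype.subsetP => k; rewrite !inE.
  apply: contraR => /norP[kx ky]; rewrite -Rmax_le0.
  by have := ca k kx; rewrite !ffunE (negbTE ky) scaler0.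
by rewrite cards2 xy leqNgt (sM c Mc).
Qed.

Lemma simple_basis_neq0 (R : realType) (E : finType) (M : valuated_matroid R E)
    (x : E) : simple M -> qpi M (basis_elt R x) != 0.
Proof.
move=> sM; apply/eqP => x0.
have : mod_le (1 *: qpi M (basis_elt R x)) (qpi M 0).
  by rewrite x0 scaler0; apply: mod_ge0.
move=> /scale_basis_le[|[c [Mc cx c0]]]; first by rewrite ffunE Rmax_le0.
have : (#|supp c| <= #|[set x]%SET|)%N.
  apply/subset_leq_card/fintype.subsetP => k; rewrite !inE.
  by apply: contraR => kx; rewrite -Rmax_le0; have := c0 k kx; rewrite ffunE.
by rewrite cards1 leqNgt (leq_trans _ (sM c Mc)).
Qed.

(** * Uniqueness up to projective equivalence *)

Section RayBases.
Variables (R : realType) (N : lSemiModType (Rmax R)).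

(** These properties of the generators of a simple matroid mention only the module, and they fix the
    family up to rescaling and reindexing. *)
Definition ray_basis (E : finType) (t : E -> N) : Prop :=
  [/\ forall x, t x != 0,
      forall x z, mod_le z (t x) -> exists r, z = r *: t x,
      forall x y r, t x = r *: t y -> x = y
    & forall z, exists w, z = lincomb t w].

(** Any nonzero term in the expansion of [t x] over [t'] lies below [t x], hence is a unit multiple
    of it. *)
Lemma ray_basis_scale (E E' : finType) (t : E -> N) (t' : E' -> N) x :
  ray_basis t -> ray_basis t' -> exists y, exists2 s, s != 0 & t x = s *: t' y.
Proof.
move=> [t0 t_ray _ _] [t'0 _ _ /(_ (t x))[w wE]].
have [y wy] : exists y, w y != 0.
  apply: contrapT => /forallNP wz; have := t0 x; rewrite wE /lincomb big1 ?eqxx // => y _.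
  by have /negP := wz y; rewrite negbK => /eqP->; rewrite scale0r.
have [r rE] : exists r, w y *: t' y = r *: t x.
  by apply: t_ray; rewrite wE; apply: lincomb_ge.
have r0 : r != 0.
  apply: contraNneq (scaler_neq0_Rmax wy (t'0 y)) => r0.
  by rewrite rE r0 scale0r.
have [b [rb b0]] := Rmax_inv r0.
exists y, (b * w y); first exact: Rmax_mulf_neq0.
by rewrite -scalerA rE scalerA mulrC rb scale1r.
Qed.

Lemma ray_basis_match (E E' : finType) (t : E -> N) (t' : E' -> N) :
  ray_basis t -> ray_basis t' ->
  exists (phi : E -> E') (psi : E' -> E) (s : E -> Rmax R),
    [/\ cancel phi psi, cancel psi phi, forall x, s x != 0
      & forall x, t x = s x *: t' (phi x)].
Proof.
move=> tB t'B.
have /choice[phi phiP] := fun x => ray_basis_scale x tB t'B.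
have /choice[psi psiP] := fun y => ray_basis_scale y t'B tB.
have /choice[s sP] : forall x, exists s, s != 0 /\ t x = s *: t' (phi x).
  by move=> x; case: (phiP x) => s s0 sE; exists s.
exists phi, psi, s; split.
- move=> x; have [r _ rE] := psiP (phi x); have [_ sE] := sP x.
  case: tB => _ _ t_indep _; apply/esym/(t_indep _ _ (s x * r)).
  by rewrite -scalerA -rE.
- move=> y; have [r _ rE] := psiP y; have [_ sE] := sP (psi y).
  case: t'B => _ _ t'_indep _; apply/esym/(t'_indep _ _ (r * s (psi y))).
  by rewrite -scalerA -sE.
- by move=> x; case: (sP x).
- by move=> x; case: (sP x).
Qed.

(** The substitution [T] is compatible with combinations, deletions and nonvanishing of coordinates,
    in terms of which [elementary] is defined. *)
Lemma elementary_reindex (E E' : finType) (t : E -> N) (t' : E' -> N)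
    (phi : E -> E') (psi : E' -> E) (s : E -> Rmax R) c :
  cancel phi psi -> cancel psi phi -> (forall x, s x != 0) ->
  (forall x, t x = s x *: t' (phi x)) ->
  elementary t c <-> elementary t' [ffun y => s (psi y) * c (psi y)].
Proof.
move=> phiK psiK s0 tE; pose T (w : {ffun E -> Rmax R}) : {ffun E' -> Rmax R} :=
  [ffun y => s (psi y) * w (psi y)].
rewrite -/(T c).
have TE w : lincomb t' (T w) = lincomb t w.
  rewrite /lincomb (reindex phi) /=; last by exists psi => y _; rewrite ?phiK ?psiK.
  by apply: eq_bigr => x _; rewrite tE ffunE phiK scalerA mulrC.
have delT w x : del (phi x) (T w) = T (del x w).
  apply/ffunP => y; rewrite !ffunE.
  have -> : (y == phi x) = (psi y == x) by rewrite -(can2_eq psiK phiK).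
  by case: ifP; rewrite ?mulr0.
have delT' w y : del y (T w) = T (del (psi y) w) by rewrite -delT psiK.
have T_neq0 w y : (T w y != 0) = (w (psi y) != 0).
  rewrite ffunE; have [->|wy] := eqVneq (w (psi y)) 0; first by rewrite mulr0 eqxx.
  by rewrite Rmax_mulf_neq0.
have T0 w : T w = 0 <-> w = 0.
  split=> [/ffunP Tw|->]; apply/ffunP => k; last by rewrite !ffunE mulr0.
  apply/eqP/negPn; rewrite ffunE -(phiK k) -T_neq0 Tw ffunE.
  by rewrite eqxx.
split=> -[c0 cb ce]; split.
- by move/T0.
- by move=> y; rewrite delT' !TE.
- move=> x y xy; rewrite !T_neq0 !delT' !TE; apply: ce.
  by rewrite (can_eq psiK).
- by move/T0.
- by move=> x; rewrite -!TE -delT.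
- move=> x y xy cx cy; rewrite -!TE -!delT; apply: ce; rewrite ?T_neq0 ?phiK //.
  by rewrite (can_eq phiK).
Qed.

Lemma elementary_inj (N' : lSemiModType (Rmax R)) (f : {linear N -> N'})
    (E : finType) (t : E -> N) c :
  injective f -> elementary t c <-> elementary (f \o t) c.
Proof.
move=> f_inj; split=> -[c0 cb ce]; split=> //.
- by move=> x; rewrite -!lincomb_linear cb.
- by move=> x y xy cx cy; rewrite -!lincomb_linear => /f_inj; apply: ce.
- by move=> x; apply: f_inj; rewrite !lincomb_linear cb.
- by move=> x y xy cx cy /(congr1 f); rewrite !lincomb_linear; apply: ce.
Qed.

(** Pulling the generators back along the isomorphism places the families of different matroids in
    one module, where they can be matched. *)
Lemma iso_simple_ray_basis (E : finType) (M : valuated_matroid R E) :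
  simple M -> isomorphic N (Q M) ->
  exists2 t : E -> N, ray_basis t & forall c, circuit M c <-> elementary t c.
Proof.
move=> sM [f [g fK gK]]; pose t x := g (qpi M (basis_elt R x)).
have f_inj := can_inj fK.
have ftE : f \o t = fun x => qpi M (basis_elt R x).
  by apply/funext => x; rewrite /= gK.
have ft x : f (t x) = qpi M (basis_elt R x) by rewrite gK.
exists t; last first.
  by move=> c; rewrite (elementary_inj _ _ f_inj) ftE -circuit_elementary.
split.
- move=> x; apply: contraNneq (simple_basis_neq0 x sM) => tx0.
  by rewrite -ft tx0 linear0.
- move=> x z zt; have /basis_ray[r _ rE] : mod_le (f z) (qpi M (basis_elt R x)).
    by rewrite -ft /mod_le -linearD zt.
  by exists r; apply: f_inj; rewrite linearZ rE -ft.
- move=> x y r tE; apply: (simple_basis (a := r) sM).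
  by rewrite -!ft tE linearZ; apply: mod_lexx.
- move=> z; have [w wE] := qpi_surj (f z); exists w; apply: f_inj.
  by rewrite lincomb_linear ftE -qpi_lincomb.
Qed.

Lemma simple_iso_projectively_equivalent (E E' : finType)
    (M : valuated_matroid R E) (M' : valuated_matroid R E') :
  simple M -> isomorphic N (Q M) -> simple M' -> isomorphic N (Q M') ->
  projectively_equivalent M M'.
Proof.
move=> sM iM sM' iM'.
have [t tB tM] := iso_simple_ray_basis sM iM.
have [t' t'B t'M'] := iso_simple_ray_basis sM' iM'.
have [phi [psi [s [phiK psiK s0 tE]]]] := ray_basis_match tB t'B.
exists phi, psi, s; split=> // eta.
by rewrite tM t'M'; apply: elementary_reindex.
Qed.

(** * Existence: finite generating families of non-proportional atoms *)

Definition in_span (S : seq N) (z : N) : Prop :=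
  exists w : {ffun seq_sub S -> Rmax R}, z = lincomb val w.

Lemma in_span_mem S z : z \in S -> in_span S z.
Proof. by move=> Sz; exists (basis_elt R (SeqSub Sz)); rewrite lincomb_basis. Qed.

Lemma in_spanZ S a z : in_span S z -> in_span S (a *: z).
Proof. by move=> [w ->]; exists (a *: w); rewrite lincombZ. Qed.

Lemma in_span_sum S (I : Type) (r : seq I) (P : pred I) (F : I -> N) :
  (forall i, P i -> in_span S (F i)) -> in_span S (\sum_(i <- r | P i) F i).
Proof.
move=> SF; elim/big_ind: _ => // [|_ _ [v ->] [w ->]].
  by exists 0; rewrite lincomb0.
by exists (v + w); rewrite lincombD.
Qed.

Lemma in_span_trans S S' z :
  {in S, forall u, in_span S' u} -> in_span S z -> in_span S' z.
Proof.
move=> SS' [w ->]; apply: in_span_sum => u _; apply/in_spanZ/SS'.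
exact: valP.
Qed.

(** Collect the atoms that occur in decompositions of the finitely many generators. *)
Lemma atomic_span : finitely_generated N -> atomic N ->
  exists S : seq N, {in S, forall u, atom u} /\ forall z, in_span S z.
Proof.
move=> [n [g gP]] /(_ (g _))atomN.
have /choice[s sP] : forall i, exists s : seq N,
    {in s, forall u, atom u} /\ g i = \sum_(u <- s) u.
  by move=> i; have [s ? ?] := atomN i; exists s.
exists (flatten [seq s i | i <- enum 'I_n]); split.
  by move=> u /flatten_mapP[i _]; apply: (sP i).1.
move=> z; have [c ->] := gP z; apply: in_span_sum => i _; apply: in_spanZ.
rewrite (sP i).2 big_seq; apply: in_span_sum => u su; apply: in_span_mem.
by apply/flatten_mapP; exists i; rewrite ?mem_enum.
Qed.

(** An atom that is a multiple of another listed one is discarded; the list shortens, so this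
    terminates. *)
Lemma independent_span S : {in S, forall u, atom u} -> (forall z, in_span S z) ->
  exists S', [/\ {in S', forall u, atom u}, forall z, in_span S' z
               & {in S' &, forall u v r, u = r *: v -> u = v}].
Proof.
have [n] := ubnP (size S); elim: n S => // n IH S; rewrite ltnS => Sn Sat Sspan.
have [indep|] := pselect {in S &, forall u v r, u = r *: v -> u = v}.
  by exists S.
move=> /existsNP[u /existsNP[v]].
move=> /not_implyP[Su /not_implyP[Sv /existsNP[r /not_implyP[uv uDv]]]].
pose S' := [seq z <- S | z != u].
have S'span : {in S, forall z, in_span S' z}.
  move=> z Sz; have [->|zu] := eqVneq z u; last first.
    by apply: in_span_mem; rewrite mem_filter zu.
  rewrite uv; apply/in_spanZ/in_span_mem; rewrite mem_filter Sv andbT.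
  by apply/eqP => vu; apply: uDv.
apply: (IH S').
- apply: leq_trans Sn; rewrite size_filter -(count_predC (pred1 u) S).
  by rewrite -[ltnLHS]add0n ltn_add2r -has_count has_pred1.
- by move=> z; rewrite mem_filter => /andP[_]; apply: Sat.
- by move=> z; apply: in_span_trans S'span (Sspan z).
Qed.

Lemma simple_matroid_exists : finitely_generated N -> atomic N ->
  semimodular N -> strongly_torsion_free N ->
  exists (E : finType) (M : valuated_matroid R E), simple M /\ isomorphic N (Q M).
Proof.
move=> fgN atN smN stfN; have [S0 [S0at S0span]] := atomic_span fgN atN.
have [S [Sat Sspan Sindep]] := independent_span S0at S0span.
pose t (x : seq_sub S) : N := val x.
have t_atom x : atom (t x) by apply: Sat; apply: valP.
exists (seq_sub S : finType), (elementary_matroid stfN smN t_atom); split.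
  move=> c; apply: elementary_supp_ge3 => //.
    (* An atom is nonzero, for otherwise the bijection from the unit ball would identify 0 and 1. *)
    move=> x; apply/eqP => tx0; have [_ [_ inj _]] := t_atom x.
    have : 0 = 1 :> Rmax R.
      apply: inj; [exact/mem_set/Rmax_ge0 | exact/mem_set/lexx |].
      by rewrite tx0 !scaler0.
    by move/eqP; rewrite eq_sym oner_eq0.
  by move=> x y r txy; apply/val_inj/(Sindep _ _ (valP x) (valP y) r).
exact: elementary_matroid_iso.
Qed.

End RayBases.

Theorem theoremD (R : realType) :
  (forall (E : finType) (M : valuated_matroid R E),
     atomic (Q M) /\ semimodular (Q M) /\ strongly_torsion_free (Q M))
  /\
  (forall N : lSemiModType (Rmax R),
     finitely_generated N ->
     atomic N -> semimodular N -> strongly_torsion_free N ->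
     (exists (E : finType) (M : valuated_matroid R E),
        simple M /\ isomorphic N (Q M))
     /\
     (forall (E E' : finType)
             (M : valuated_matroid R E) (M' : valuated_matroid R E'),
        simple M -> isomorphic N (Q M) ->
        simple M' -> isomorphic N (Q M') ->
        projectively_equivalent M M')).
Proof.
split=> [E M|N fgN atN smN stfN].
  split; first exact: Q_atomic.
  by split; [apply: Q_semimodular | apply: Q_strongly_torsion_free].
split; first exact: simple_matroid_exists.
exact: simple_iso_projectively_equivalent.
Qed.
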